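(* Let $G_1$ and $G_2$ be arbitrary groups and $H\le G_1\times G_2$ a subgroup. There exist a set $I$ and a morphism $\varphi\colon\mathcal{G}_1\to\mathcal{G}_2$ of binary relational systems over $I$ such that $\operatorname{Aut}_{I\mathcal{R}el}(\mathcal{G}_1)$, $\operatorname{Aut}_{I\mathcal{R}el}(\mathcal{G}_2)$ and $\operatorname{Aut}_{I\mathcal{R}el}(\varphi)$ are isomorphic, respectively, to $G_1$, $G_2$ and $H$.
   Context: A binary relational system $\mathcal{S}$ over a set $I$ (binary $I$-system) is a set $V(\mathcal{S})$ of vertices together with a family of binary relations $R_i(\mathcal{S})\subseteq V(\mathcal{S})\times V(\mathcal{S})$, $i\in I$. A morphism $f\colon\mathcal{S}_1\to\mathcal{S}_2$ of binary $I$-systems is a map $f\colon V(\mathcal{S}_1)\to V(\mathcal{S}_2)$ such that $(f(v),f(w))\in R_i(\mathcal{S}_2)$ whenever $(v,w)\in R_i(\mathcal{S}_1)$, $i\in I$. $\operatorname{Aut}_{I\mathcal{R}el}(\mathcal{S})$ is the automorphism group of $\mathcal{S}$ in the resulting category. For a morphism $\varphi\colon\mathcal{G}_1\to\mathcal{G}_2$, $\operatorname{Aut}_{I\mathcal{R}el}(\varphi)$ is the group of pairs $(a,b)\in\operatorname{Aut}_{I\mathcal{R}el}(\mathcal{G}_1)\times\operatorname{Aut}_{I\mathcal{R}el}(\mathcal{G}_2)$ with $b\circ\varphi=\varphi\circ a$. *)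

(* Defs.v *)
From HB Require Import structures.
From mathcomp Require Import all_boot.
From mathcomp Require Import boolp.

Set Implicit Arguments.
Unset Strict Implicit.
Unset Printing Implicit Defensive.

Local Open Scope group_scope.

Record binsys (I : Type) := BinSys {
  vertex : Type;
  edge : I -> vertex -> vertex -> Prop }.

Record hom (I : Type) (S T : binsys I) := Hom {
  hom_fun :> vertex S -> vertex T;
  hom_edge : forall (i : I) (v w : vertex S),
    edge i v w -> edge i (hom_fun v) (hom_fun w) }.

Lemma hom_ext (I : Type) (S T : binsys I) (f g : hom S T) : f =1 g -> f = g.
Proof.
case: f g => [f fE] [g gE] /= /funext fg; case: _ / fg in gE *.
by congr Hom; exact: Prop_irrelevance.
Qed.

Definition hom_id (I : Type) (S : binsys I) : hom S S :=
  @Hom I S S id (fun i v w vw => vw).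

Definition hom_comp (I : Type) (S T U : binsys I) (g : hom T U) (f : hom S T) :
    hom S U :=
  @Hom I S U (g \o f) (fun i v w vw => hom_edge g (hom_edge f vw)).

(* Automorphisms carry their inverse, which must itself be a morphism: a
   bijective morphism of relational systems need not be invertible. *)
Record aut (I : Type) (S : binsys I) := Aut {
  aut_hom :> hom S S;
  aut_inv : hom S S;
  aut_invK : hom_comp aut_inv aut_hom = hom_id S;
  aut_homK : hom_comp aut_hom aut_inv = hom_id S }.

Section AutGroup.
Variables (I : Type) (S : binsys I).
Implicit Types a b c : aut S.

Lemma autK a : cancel a (aut_inv a).
Proof. by move=> v; have := congr1 (fun f : hom S S => f v) (aut_invK a). Qed.

Lemma autVK a : cancel (aut_inv a) a.
Proof. by move=> v; have := congr1 (fun f : hom S S => f v) (aut_homK a). Qed.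

Lemma aut_ext a b : a =1 b -> a = b.
Proof.
move=> ab; have abV : aut_inv a = aut_inv b.
  by apply: hom_ext => v; rewrite -{1}(autVK b v) -ab autK.
move/hom_ext: ab abV; case: a b => [f g fK gK] [f' g' fK' gK'] /= ff' gg'.
case: _ / ff' in fK' gK' *; case: _ / gg' in fK' gK' *.
by congr Aut; exact: Prop_irrelevance.
Qed.

Definition aut1 : aut S := @Aut I S (hom_id S) (hom_id S) erefl erefl.

Definition autV a : aut S := Aut (aut_homK a) (aut_invK a).

Fact autM_invK a b :
  hom_comp (hom_comp (aut_inv b) (aut_inv a)) (hom_comp a b) = hom_id S.
Proof. by apply: hom_ext => v /=; rewrite !autK. Qed.

Fact autM_homK a b :
  hom_comp (hom_comp a b) (hom_comp (aut_inv b) (aut_inv a)) = hom_id S.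
Proof. by apply: hom_ext => v /=; rewrite !autVK. Qed.

Definition autM a b : aut S := Aut (autM_invK a b) (autM_homK a b).

Fact autMA : associative autM. Proof. by move=> a b c; apply: aut_ext. Qed.
Fact autM1l : left_id aut1 autM. Proof. by move=> a; apply: aut_ext. Qed.
Fact autM1r : right_id aut1 autM. Proof. by move=> a; apply: aut_ext. Qed.
Fact autMVl : left_inverse aut1 autV autM.
Proof. by move=> a; apply: aut_ext => v; exact: autK. Qed.
Fact autMVr : right_inverse aut1 autV autM.
Proof. by move=> a; apply: aut_ext => v; exact: autVK. Qed.

HB.instance Definition _ := gen_eqMixin (aut S).
HB.instance Definition _ := gen_choiceMixin (aut S).
HB.instance Definition _ :=
  isGroup.Build (aut S) autMA autM1l autM1r autMVl autMVr.

End AutGroup.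

(* A subgroup, given as a boolean predicate closed under the group operations,
   turned into a group in its own right.  Booleans are no restriction here:
   [boolp] turns every Prop-valued predicate into a boolean one. *)
Definition subgroup_of (G : groupType) (H : groupClosed G) : Type :=
  {x : G | x \in H}.

Section SubgroupOf.
Variables (G : groupType) (H : groupClosed G).

Fact subgroup_of_closed : group_closed H.
Proof.
by split=> [|x y Hx Hy]; [exact: gpred1 | apply: gpredM => //; rewrite gpredV].
Qed.

HB.instance Definition _ := SubChoice.on (subgroup_of H).
HB.instance Definition _ :=
  SubChoice_isSubGroup.Build G (mem H) (subgroup_of H) subgroup_of_closed.

End SubgroupOf.

Definition group_closed_pack (G : groupType) (P : {pred G})
    (P1 : 1 \in P) (PM : mulg_closed P) (PV : invg_closed P) : groupClosed G :=
  HB.pack P (isMul1Closed.Build G P P1) (isMulClosed.Build G P PM)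
    (isInvClosed.Build G P PV).

Section AutHom.
Variables (I : Type) (S T : binsys I) (phi : hom S T).

Definition aut_hom_pred : {pred aut S * aut T} :=
  fun ab => `[< hom_comp ab.2 phi = hom_comp phi ab.1 >].

Fact aut_hom_pred1 : 1 \in aut_hom_pred.
Proof. by apply/asboolP; exact: hom_ext. Qed.

Fact aut_hom_predM : mulg_closed aut_hom_pred.
Proof.
move=> [a b] [a' b'] /asboolP/= ab /asboolP/= ab'.
have e v := congr1 (fun f : hom S T => f v) ab.
have e' v := congr1 (fun f : hom S T => f v) ab'.
by apply/asboolP/hom_ext => v /=; move: (e' v) (e (a' v)) => /= -> ->.
Qed.

Fact aut_hom_predV : invg_closed aut_hom_pred.
Proof.
move=> [a b] /asboolP/= ab; apply/asboolP/hom_ext => v /=.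
have := congr1 (fun f : hom S T => f (aut_inv a v)) ab.
by rewrite /= autVK => <-; rewrite autK.
Qed.

Definition aut_of_hom : groupType :=
  subgroup_of (group_closed_pack aut_hom_pred1 aut_hom_predM aut_hom_predV).

End AutHom.

Definition isomorphic (G K : groupType) : Prop :=
  exists f : UMagmaMorphism.type G K, bijective f.

(* Main.v *)
Require Import Defs.
From HB Require Import structures.
From mathcomp Require Import all_boot.
From mathcomp Require Import boolp.

(** Every group [G] is the automorphism group of a relational system on its
    power set: the relations are chosen so that the automorphisms are exactly
    the left translations [A |-> h A] ([translation_bij]).  The point of taking
    all subsets, rather than the elements of [G] as in a Cayley graph, is that
    a subgroup [H] of [G1 * G2] is itself a map between power sets, namely the
    image map
      [A |-> {y | (x, y) \in H for some x \in A}].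
    Translation by [h1] on the source and by [h2] on the target commute with
    this map if and only if [(h1, h2) \in H] ([translations_commute_iff]): on
    the singleton of [1] the two composites are [{y | (h1, y) \in H}] and
    [{h2 y | (1, y) \in H}], and the second contains [h2]; the converse holds
    because [H] is stable under multiplication by [(h1, h2)] and its inverse.
    Hence the automorphisms of the image map form a copy of [H].

    The image map also has to be a morphism.  This costs nothing: over the index
    set [G1 + G2], the relations indexed by [G2] are empty in the first system
    and those indexed by [G1] are total in the second, so that every map between
    the vertex sets is a morphism, while empty and total relations do not
    constrain automorphisms. *)

Set Implicit Arguments.
Unset Strict Implicit.
Unset Printing Implicit Defensive.

Local Open Scope group_scope.

Lemma isomorphic_of_cancel (G K : groupType) (f : G -> K) (g : K -> G) :
  {morph f : x y / x * y} -> cancel f g -> cancel g f -> isomorphic K G.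
Proof.
move=> fM fK gK; have fI := can_inj fK.
have gM : {morph g : x y / x * y} by move=> x y; apply: fI; rewrite fM !gK.
have g1 : g 1 = 1.
  by apply: (@mulgI _ (g 1)); rewrite -gM !mulg1.
pose gmor : UMagmaMorphism.type K G :=
  HB.pack g (isUMagmaMorphism.Build K G g (g1, gM)).
by exists gmor; exists f.
Qed.

Lemma isomorphic_subgroup (G K : groupType) (H : groupClosed G)
    (L : groupClosed K) (f : G -> K) :
  {morph f : x y / x * y} -> bijective f ->
  (forall x, (f x \in L) = (x \in H)) ->
  isomorphic (subgroup_of L) (subgroup_of H).
Proof.
move=> fM [g fK gK] fLH.
have fH (x : subgroup_of H) : f (\val x) \in L by rewrite fLH (valP x).
have gL (y : subgroup_of L) : g (\val y) \in H by rewrite -fLH gK (valP y).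
pose fs (x : subgroup_of H) : subgroup_of L := Sub (f (\val x)) (fH x).
pose gs (y : subgroup_of L) : subgroup_of H := Sub (g (\val y)) (gL y).
apply: (@isomorphic_of_cancel _ _ fs gs).
- by move=> x y; apply: val_inj; rewrite /= fM.
- by move=> x; apply: val_inj; rewrite /= fK.
- by move=> y; apply: val_inj; rewrite /= gK.
Qed.

Lemma eq_inj (T : Type) : injective (@eq T).
Proof. by move=> x y xy; rewrite xy. Qed.

Section Translate.
Variable G : groupType.
Implicit Types (h : G) (A : G -> Prop).

Definition translate h A : G -> Prop := fun x => A (h^-1 * x).

Lemma translateM h k A : translate (h * k) A = translate h (translate k A).
Proof. by apply/funext => x; rewrite /translate invgM mulgA. Qed.

Lemma translateK h : cancel (translate h) (translate h^-1).
Proof. by move=> A; apply/funext => x; rewrite /translate invgK mulKg. Qed.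

Lemma translate_eq h y : translate h (eq y) = eq (h * y).
Proof.
apply/funext => x; apply/propext; rewrite /translate; split=> [->|<-].
  by rewrite mulVKg.
by rewrite mulKg.
Qed.

End Translate.

Section SubsetSystem.
Variables (I : Type) (G : groupType) (label : I -> option G) (P : Prop).

(** The relation labelled [g] joins the singleton of [y] to the sets containing
    [y g].  It thus combines the Cayley graph of [G], on singletons, with the
    membership relation, which forces an automorphism to act on a set through
    its action on elements.  Unlabelled indices carry the relation that is
    constantly [P]. *)
Definition subset_system : binsys I := {|
  vertex := G -> Prop;
  edge i A B := if label i is Some g
                then exists2 y, A = eq y & B (y * g) else P |}.

Lemma translate_edge h i (A B : vertex subset_system) :
  edge i A B -> @edge _ subset_system i (translate h A) (translate h B).
Proof.
rewrite /=; case: (label i) => // g [y -> By].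
by exists (h * y); [exact: translate_eq | rewrite /translate -mulgA mulKg].
Qed.

Definition translate_hom h : hom subset_system subset_system :=
  @Hom _ subset_system subset_system (translate h) (translate_edge h).

Fact translate_invK h :
  hom_comp (translate_hom h^-1) (translate_hom h) = hom_id subset_system.
Proof. by apply: hom_ext => A /=; rewrite translateK. Qed.

Fact translate_homK h :
  hom_comp (translate_hom h) (translate_hom h^-1) = hom_id subset_system.
Proof. by apply: hom_ext => A /=; rewrite -{1}(invgK h) translateK. Qed.

Definition translation h : aut subset_system :=
  Aut (translate_invK h) (translate_homK h).

Lemma translationM : {morph translation : h k / h * k}.
Proof. by move=> h k; apply: aut_ext => A; exact: translateM. Qed.

Lemma translation_inj : injective translation.
Proof.
move=> h k /(congr1 (fun a : aut subset_system => a (eq 1))) /=.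
by rewrite !translate_eq !mulg1; exact: eq_inj.
Qed.

Hypothesis label_surj : forall g, exists i, label i = Some g.

(** Singletons are the vertices with an outgoing edge labelled [1], so an
    automorphism [a] sends the singleton of [1] to that of some [h].  A set [B]
    is determined by the labels [g] of the edges from the singleton of [1] to
    [B], hence [a B] contains [h g] exactly when [B] contains [g]. *)
Lemma aut_is_translation (a : aut subset_system) :
  exists h, a = translation h.
Proof.
have edgeP i g (A B : G -> Prop) : label i = Some g ->
    @edge _ subset_system i A B = exists2 y, A = eq y & B (y * g).
  by move=> /= ->.
have [h a1] : exists h, a (eq 1) = eq h.
  have [i ig] := label_surj 1.
  have : @edge _ subset_system i (eq 1) (eq 1).
    by rewrite (edgeP _ _ _ _ ig); exists 1; rewrite ?mulg1.
  by move=> /(hom_edge a); rewrite (edgeP _ _ _ _ ig) => -[h]; exists h.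
exists h; apply: aut_ext => B; apply/funext => x; apply/propext.
rewrite /= /translate; have [i ig] := label_surj (h^-1 * x).
split=> [aBx | Bx].
- have : @edge _ subset_system i (a (eq 1)) (a B).
    by rewrite (edgeP _ _ _ _ ig); exists h => //; rewrite mulVKg.
  move/(hom_edge (aut_inv a)); rewrite !autK (edgeP _ _ _ _ ig).
  by case=> y /(@eq_inj G) <-; rewrite mul1g.
- have : @edge _ subset_system i (eq 1) B.
    by rewrite (edgeP _ _ _ _ ig); exists 1; rewrite ?mul1g.
  move/(hom_edge a); rewrite a1 (edgeP _ _ _ _ ig).
  by case=> y /(@eq_inj G) <-; rewrite mulVKg.
Qed.

Lemma translation_bij : bijective translation.
Proof.
have [s sK] := choice aut_is_translation.
by exists s => [h|a]; [apply: translation_inj|]; exact/esym/sK.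
Qed.

Lemma aut_subset_system : isomorphic (aut subset_system) G.
Proof.
have [s tK sK] := translation_bij.
exact: isomorphic_of_cancel translationM tK sK.
Qed.

End SubsetSystem.

Section ImageMap.
Variables (G1 G2 : groupType) (H : groupClosed (G1 * G2)%type).

Definition left_label (i : G1 + G2) := if i is inl g then Some g else None.
Definition right_label (i : G1 + G2) := if i is inr g then Some g else None.

Fact left_label_surj g : exists i, left_label i = Some g.
Proof. by exists (inl g). Qed.

Fact right_label_surj g : exists i, right_label i = Some g.
Proof. by exists (inr g). Qed.

Definition source : binsys (G1 + G2) := subset_system left_label False.
Definition target : binsys (G1 + G2) := subset_system right_label True.

Definition image_under (A : G1 -> Prop) : G2 -> Prop :=
  fun y => exists2 x, A x & (x, y) \in H.

Lemma image_under_edge i (A B : vertex source) :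
  edge i A B -> @edge _ target i (image_under A) (image_under B).
Proof. by case: i. Qed.

Definition image_hom : hom source target := Hom image_under_edge.

Lemma translations_commute_iff h1 h2 :
  (forall A, translate h2 (image_under A) = image_under (translate h1 A)) <->
  (h1, h2) \in H.
Proof.
split=> [comm | Hh A].
  have := congr1 (fun B : G2 -> Prop => B h2) (comm (eq 1)).
  rewrite translate_eq mulg1 /translate mulVg /image_under => e.
  have : exists2 x : G1, 1 = x & (x, 1 : G2) \in H.
    by exists 1 => //; exact: gpred1.
  by rewrite e => -[x <-].
have HV : (h1^-1, h2^-1) \in H.
  by rewrite -[_ \in H]/((h1, h2)^-1 \in H) gpredV.
apply/funext => y; apply/propext; rewrite /translate /image_under.
split=> -[x Ax Hxy].
- exists (h1 * x); first by rewrite mulKg.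
  have := gpredM _ _ Hh Hxy.
  by rewrite -[(_, _) * _]/(h1 * x, h2 * (h2^-1 * y)) mulVKg.
- by exists (h1^-1 * x) => //; exact: gpredM HV Hxy.
Qed.

Definition translations (h : G1 * G2) : aut source * aut target :=
  (translation _ _ h.1, translation _ _ h.2).

Lemma aut_image_hom : isomorphic (aut_of_hom image_hom) (subgroup_of H).
Proof.
apply: (@isomorphic_subgroup _ _ _ _ translations).
- by move=> h k; rewrite /translations !translationM.
- have [s1 t1K s1K] := translation_bij False left_label_surj.
  have [s2 t2K s2K] := translation_bij True right_label_surj.
  exists (fun ab => (s1 ab.1, s2 ab.2)).
    by case=> h1 h2; rewrite /= t1K t2K.
  by case=> a b; rewrite /translations /= s1K s2K.
- case=> h1 h2; apply/asboolP/idP => [e | /translations_commute_iff comm].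
    apply/translations_commute_iff => A.
    exact: (congr1 (fun f : hom source target => f A) e).
  by apply: hom_ext => A; exact: comm.
Qed.

End ImageMap.

Theorem theorem2p2 (G1 G2 : groupType) (H : groupClosed (G1 * G2)%type) :
  exists (I : Type) (S1 S2 : binsys I) (phi : hom S1 S2),
    [/\ isomorphic (aut S1) G1, isomorphic (aut S2) G2
      & isomorphic (aut_of_hom phi) (subgroup_of H)].
Proof.
exists (G1 + G2)%type, (source G1 G2), (target G1 G2), (image_hom H); split.
- exact/aut_subset_system/left_label_surj.
- exact/aut_subset_system/right_label_surj.
- exact: aut_image_hom.
Qed.
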